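(* Let $\mathscr{G}$ be a quiver skew brace. The ideals of $\mathscr{G}$ are exactly the kernels of morphisms of quiver skew braces $f\colon\mathscr{G}\to\mathscr{H}$ (with $\mathscr{H}$ an arbitrary quiver skew brace). The ideal bundles of $\mathscr{G}$ are exactly the kernels of strong morphisms of quiver skew braces over $\mathscr{G}^0$ with domain $\mathscr{G}$.
   Context: A groupoid $\mathscr{G}$ has set of arrows $\mathscr{G}^1$, set of vertices $\mathscr{G}^0$, source and target maps $\mathfrak{s},\mathfrak{t}$; the product $xy$ is defined when $\mathfrak{t}(x)=\mathfrak{s}(y)$; $1_\lambda$ is the unit at $\lambda$. The star at $\lambda$ is $\mathrm{St}_{\mathscr{G}}(\lambda)=\{x\in\mathscr{G}^1 : \mathfrak{s}(x)=\lambda\}$. A morphism of groupoids is a pair $f=(f^1,f^0)$ of maps on arrows and vertices compatible with sources, targets and products. A quiver skew brace is a groupoid $(\mathscr{G},\cdot)$ with, for every $\lambda\in\mathscr{G}^0$, a (not necessarily abelian) group operation $+_\lambda$ on $\mathrm{St}_{\mathscr{G}}(\lambda)$, such that $a(b+_{\mathfrak{t}(a)}c)=ab-_{\mathfrak{s}(a)}a+_{\mathfrak{s}(a)}ac$ whenever $\mathfrak{t}(a)=\mathfrak{s}(b)=\mathfrak{s}(c)$ (then $1_\lambda$ is the neutral element of $+_\lambda$). Put $a\rightharpoonup b=-a+ab$ for $\mathfrak{t}(a)=\mathfrak{s}(b)$, computed in $(\mathrm{St}_{\mathscr{G}}(\mathfrak{s}(a)),+_{\mathfrak{s}(a)})$.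 A morphism of quiver skew braces is a morphism of groupoids that induces group homomorphisms between the additive star-groups; it is strong (over $\Lambda$) if both sides have vertex set $\Lambda$ and $f^0=\mathrm{id}_\Lambda$. The kernel of $f$ is the wide subgroupoid of $\mathscr{G}$ consisting of the arrows $x$ such that $f^1(x)$ is a unit. A normal subgroupoid is a wide subgroupoid $\mathscr{I}$ (i.e. $\mathscr{I}^0=\mathscr{G}^0$) such that $g^{-1}xg\in\mathscr{I}^1$ for every $g\in\mathscr{G}^1$ and every loop $x\in\mathscr{I}^1$ at $\mathfrak{s}(g)$. An ideal of $\mathscr{G}$ is a normal subgroupoid $\mathscr{I}$ such that $\mathrm{St}_{\mathscr{I}}(\lambda)$ is an additive subgroup of $\mathrm{St}_{\mathscr{G}}(\lambda)$ for all $\lambda$, and for all $a\in\mathscr{G}^1$: $a+_{\mathfrak{s}(a)}\mathrm{St}_{\mathscr{I}}(\mathfrak{s}(a))=\mathrm{St}_{\mathscr{I}}(\mathfrak{s}(a))+_{\mathfrak{s}(a)}a$ and $a\rightharpoonup\mathrm{St}_{\mathscr{I}}(\mathfrak{t}(a))\subseteq\mathrm{St}_{\mathscr{I}}(\mathfrak{s}(a))$. An ideal is an ideal bundle if moreover it is a subgroup bundle, i.e. every arrow of $\mathscr{I}$ is a loop. *)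

(* Defs.v *)
From mathcomp Require Import all_boot.
From mathcomp Require Import boolp classical_sets.

Set Implicit Arguments.
Unset Strict Implicit.
Unset Printing Implicit Defensive.

Local Open Scope classical_set_scope.

Declare Scope brace_scope.
Delimit Scope brace_scope with brace.

(* Groupoids with vertex set [V].  The product is in diagrammatic order; as a
   function it is total, but it is only meaningful (and only constrained) on
   composable pairs, i.e. when [tgt x = src y]. *)
Record groupoid (V : Type) : Type := Groupoid {
  arrow :> Type;
  src : arrow -> V;
  tgt : arrow -> V;
  one : V -> arrow;
  mul : arrow -> arrow -> arrow;
  inv : arrow -> arrow;
  src_one : forall v, src (one v) = v;
  tgt_one : forall v, tgt (one v) = v;
  src_mul : forall x y, tgt x = src y -> src (mul x y) = src x;
  tgt_mul : forall x y, tgt x = src y -> tgt (mul x y) = tgt y;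
  mul_assoc : forall x y z, tgt x = src y -> tgt y = src z ->
    mul x (mul y z) = mul (mul x y) z;
  mul_onel : forall x, mul (one (src x)) x = x;
  mul_oner : forall x, mul x (one (tgt x)) = x;
  src_inv : forall x, src (inv x) = tgt x;
  tgt_inv : forall x, tgt (inv x) = src x;
  mul_invr : forall x, mul x (inv x) = one (src x);
  mul_invl : forall x, mul (inv x) x = one (tgt x)
}.

Notation "x * y" := (mul x y) : brace_scope.
Local Open Scope brace_scope.

Definition star V (G : groupoid V) (v : V) : set G := [set x | src x = v].
Arguments star {V} G v.

(* The family of group operations [+_v] on the stars is encoded by one operation
   [add], only meaningful on arrows with the same source; [zero v] is the neutral
   element of [+_v]. *)
Record quiver_skew_brace (V : Type) : Type := QuiverSkewBrace {
  brace_groupoid :> groupoid V;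
  zero : V -> brace_groupoid;
  add : brace_groupoid -> brace_groupoid -> brace_groupoid;
  opp : brace_groupoid -> brace_groupoid;
  src_zero : forall v, src (zero v) = v;
  src_add : forall x y, src x = src y -> src (add x y) = src x;
  src_opp : forall x, src (opp x) = src x;
  add_assoc : forall x y z, src x = src y -> src y = src z ->
    add x (add y z) = add (add x y) z;
  add_zerol : forall x, add (zero (src x)) x = x;
  add_zeror : forall x, add x (zero (src x)) = x;
  add_oppl : forall x, add (opp x) x = zero (src x);
  add_oppr : forall x, add x (opp x) = zero (src x);
  mul_add : forall a b c, tgt a = src b -> tgt a = src c ->
    a * add b c = add (add (a * b) (opp a)) (a * c)
}.

Notation "x + y" := (add x y) : brace_scope.
Notation "- x" := (opp x) : brace_scope.

Lemma zero_one V (G : quiver_skew_brace V) (v : V) : zero G v = one G v.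
Proof.
have s1 := src_one G v; have sz := src_zero G v; have t1 := tgt_one G v.
have m1z : one G v * zero G v = zero G v by rewrite -{1}sz mul_onel.
have zz : zero G v + zero G v = zero G v by rewrite -{1}sz add_zerol.
have z1 : zero G v + - one G v = - one G v.
  by rewrite -{1}s1 -src_opp add_zerol.
have N1z : - one G v + zero G v = - one G v.
  by rewrite -{2}s1 -src_opp add_zeror.
have : one G v * (zero G v + zero G v) = - one G v.
  by rewrite mul_add ?t1 ?sz// m1z z1 N1z.
rewrite zz m1z => zN.
have := add_oppr (one G v); rewrite -zN s1 => <-.
by rewrite -{2}s1 add_zeror.
Qed.

Definition act V (G : quiver_skew_brace V) (a b : G) : G := - a + a * b.

Record groupoid_morphism V W (G : groupoid V) (H : groupoid W) : Type :=
  GroupoidMorphism {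
    arrow_map :> G -> H;
    vertex_map : V -> W;
    morph_src : forall x, src (arrow_map x) = vertex_map (src x);
    morph_tgt : forall x, tgt (arrow_map x) = vertex_map (tgt x);
    morph_mul : forall x y, tgt x = src y ->
      arrow_map (x * y) = arrow_map x * arrow_map y
  }.

Record brace_morphism V W (G : quiver_skew_brace V) (H : quiver_skew_brace W) :
    Type := BraceMorphism {
  morph_groupoid :> groupoid_morphism G H;
  morph_add : forall x y, src x = src y ->
    morph_groupoid (x + y) = morph_groupoid x + morph_groupoid y
}.

Definition strong V (G H : quiver_skew_brace V) (f : brace_morphism G H) : Prop :=
  forall v, vertex_map f v = v.

Definition kernel V W (G : quiver_skew_brace V) (H : quiver_skew_brace W)
    (f : brace_morphism G H) : set G :=
  [set x | exists w, f x = one H w].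

(* A wide subgroupoid is represented by its set of arrows, which determines it. *)
Definition wide_subgroupoid V (G : groupoid V) (I : set G) : Prop :=
  [/\ forall v, I (one G v),
      forall x y, I x -> I y -> tgt x = src y -> I (x * y)
    & forall x, I x -> I (inv x)].

Definition normal_subgroupoid V (G : groupoid V) (I : set G) : Prop :=
  wide_subgroupoid I /\
  forall g x, I x -> src x = src g -> tgt x = src g -> I (inv g * x * g).

Definition star_in V (G : groupoid V) (I : set G) (v : V) : set G :=
  I `&` star G v.

Definition additive_subgroup V (G : quiver_skew_brace V) (v : V) (A : set G) :
    Prop :=
  [/\ A `<=` star G v,
      A (zero G v),
      forall x y, A x -> A y -> A (x + y)
    & forall x, A x -> A (- x)].

Definition ideal V (G : quiver_skew_brace V) (I : set G) : Prop :=
  [/\ normal_subgroupoid I,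
      forall v, additive_subgroup v (star_in I v),
      forall a : G, [set a + x | x in star_in I (src a)] =
                    [set x + a | x in star_in I (src a)]
    & forall a : G, [set act a x | x in star_in I (tgt a)] `<=`
                    star_in I (src a)].

Definition ideal_bundle V (G : quiver_skew_brace V) (I : set G) : Prop :=
  ideal I /\ forall x, I x -> src x = tgt x.

(* Main.v *)
Require Import Defs.
From mathcomp Require Import all_boot.
From mathcomp Require Import boolp classical_sets.
Import Defs.

Set Implicit Arguments.
Unset Strict Implicit.
Unset Printing Implicit Defensive.

(* For the converse, the quotient of [G] by an ideal [I] identifies [a] with
   [i a j] for all composable [i, j] in [I], and vertices joined by an arrow of
   [I].  On a single star these classes are the cosets [a + I = a I], and
   translating between stars along [i] in [I] is additive modulo [I], because
   [i (a + b) = i a - i + i b] and [I] is additively normal.  When [I] is a bundle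
   no vertices are identified, so the projection is strong. *)

Local Open Scope classical_set_scope.
Local Open Scope brace_scope.

(** As [mul] and [add] are total but constrained only on suitable pairs, most rewritings leave
    conditions on sources and targets, which are discharged here. *)
Ltac ends :=
  rewrite ?(src_one, tgt_one, src_inv, tgt_inv, src_opp, src_zero);
  solve [ congruence
        | rewrite src_mul; [ends | ends]
        | rewrite tgt_mul; [ends | ends]
        | rewrite src_add; [ends | ends] ].

(** * Cancellation laws for arrows and in the additive star-groups *)

Section Arithmetic.
Context (V : Type) (G : quiver_skew_brace V).
Implicit Types a b x y : G.

Lemma mulKg a b : tgt a = src b -> inv a * (a * b) = b.
Proof. by move=> ab; rewrite mul_assoc ?mul_invl ?ab ?mul_onel//; ends. Qed.

Lemma mulKVg a b : src a = src b -> a * (inv a * b) = b.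
Proof. by move=> ab; rewrite mul_assoc ?mul_invr ?ab ?mul_onel//; ends. Qed.

Lemma mulgK a b : tgt a = src b -> (a * b) * inv b = a.
Proof. by move=> ab; rewrite -mul_assoc ?mul_invr -?ab ?mul_oner//; ends. Qed.

Lemma inv_unique a b : tgt a = src b -> a * b = one G (src a) -> b = inv a.
Proof.
by move=> ab ab1; rewrite -(mulKg ab) ab1 -(tgt_inv a) mul_oner.
Qed.

(** Cancel [x] on the left. This yields preservation of units by morphisms, which are only assumed
    to respect endpoints and products. *)
Lemma one_idem x : tgt x = src x -> x * x = x -> x = one G (src x).
Proof. by move=> tx xx; rewrite -{1}(mulKg tx) xx mul_invl tx. Qed.

Lemma addKg a b : src a = src b -> - a + (a + b) = b.
Proof. by move=> ab; rewrite add_assoc ?add_oppl ?ab ?add_zerol//; ends. Qed.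

Lemma addKVg a b : src a = src b -> a + (- a + b) = b.
Proof. by move=> ab; rewrite add_assoc ?add_oppr ?ab ?add_zerol//; ends. Qed.

Lemma addgK a b : src a = src b -> (a + b) + - b = a.
Proof. by move=> ab; rewrite -add_assoc ?add_oppr -?ab ?add_zeror//; ends. Qed.

Lemma addgKV a b : src a = src b -> (a + - b) + b = a.
Proof. by move=> ab; rewrite -add_assoc ?add_oppl -?ab ?add_zeror//; ends. Qed.

Lemma opp_unique a b : src a = src b -> a + b = zero G (src a) -> b = - a.
Proof. by move=> ab ab0; rewrite -(addKg ab) ab0 -(src_opp a) add_zeror. Qed.

Lemma src_act a b : tgt a = src b -> src (act a b) = src a.
Proof. by move=> ab; rewrite /act; ends. Qed.

End Arithmetic.

(** * Kernels are ideals *)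

Section Kernel.
Context (V W : Type) (G : quiver_skew_brace V) (H : quiver_skew_brace W).
Variable f : brace_morphism G H.

Lemma morph_one v : f (one G v) = one H (vertex_map f v).
Proof.
rewrite (@one_idem _ _ (f (one G v))).
- by rewrite morph_src src_one.
- by rewrite morph_src morph_tgt src_one tgt_one.
- by rewrite -morph_mul ?tgt_one ?src_one// -{1}(src_one G v) mul_onel.
Qed.

Lemma morph_inv x : f (inv x) = inv (f x).
Proof.
apply: inv_unique; rewrite ?morph_src ?morph_tgt; first by ends.
by rewrite -morph_mul ?mul_invr ?morph_one; ends.
Qed.

Lemma morph_zero v : f (zero G v) = zero H (vertex_map f v).
Proof. by rewrite !zero_one morph_one. Qed.

Lemma morph_opp x : f (- x) = - f x.
Proof.
apply: opp_unique; first by rewrite !morph_src src_opp.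
by rewrite -morph_add ?src_opp// add_oppr morph_zero morph_src.
Qed.

(** Comparing sources determines the vertex of the unit. *)
Lemma kernelP x : kernel f x <-> f x = one H (vertex_map f (src x)).
Proof.
split=> [[w fx]|fx]; last by exists (vertex_map f (src x)).
by rewrite -morph_src fx src_one.
Qed.

(** Units are loops. For a strong morphism this makes the kernel a subgroup bundle. *)
Lemma kernel_ends x : kernel f x -> vertex_map f (src x) = vertex_map f (tgt x).
Proof. by move=> [w fx]; rewrite -morph_src -morph_tgt fx src_one tgt_one. Qed.

(** Additive normality of the kernel: cancel [f a] in [f a + f x = f y + f a]. *)
Lemma kernel_add_comm a x y : src x = src a -> src y = src a ->
  a + x = y + a -> kernel f x <-> kernel f y.
Proof.
move=> xa ya /(congr1 f); rewrite !morph_add// => e.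
rewrite !kernelP xa ya -!zero_one -morph_src.
have fxa : src (f x) = src (f a) by rewrite !morph_src xa.
have fya : src (f y) = src (f a) by rewrite !morph_src ya.
split=> z.
- by rewrite -(addgK fya) -e z add_zeror add_oppr.
- by rewrite -(@addKg _ _ (f a) (f x))// e z add_zerol add_oppl.
Qed.

Lemma kernel_ideal : ideal (kernel f).
Proof.
split.
- split; first split.
  + by move=> v; apply/kernelP; rewrite morph_one src_one.
  + move=> x y /[dup] kx /kernelP fx /kernelP fy xy; apply/kernelP.
    rewrite morph_mul// fx fy -xy -kernel_ends// src_mul//.
    by rewrite -{1}(src_one H (vertex_map _ _)) mul_onel.
  + move=> x kx; apply/kernelP; rewrite src_inv -kernel_ends// morph_inv.
    move/kernelP: kx => ->; symmetry.
    apply: inv_unique; rewrite ?src_one ?tgt_one//.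
    by rewrite -{1}(src_one H (vertex_map _ _)) mul_onel.
  + move=> g x /kernelP fx sx tx; exists (vertex_map f (tgt g)).
    rewrite morph_mul; [|ends]; rewrite morph_mul; [|ends].
    rewrite fx sx -morph_src -{1}tgt_inv morph_inv mul_oner mul_invl.
    by rewrite morph_tgt.
- move=> v; split.
  + by move=> x [].
  + by split; rewrite ?/star/= ?src_zero//; exists (vertex_map f v);
      rewrite morph_zero zero_one.
  + move=> x y [/kernelP fx sx] [/kernelP fy sy]; rewrite /star/= in sx sy.
    have sxy : src x = src y by ends.
    split; last by rewrite /star/=; ends.
    apply/kernelP; rewrite morph_add// fx fy src_add// sy sx -!zero_one.
    by rewrite -{1}(src_zero H (vertex_map _ _)) add_zerol.
  + move=> x [/kernelP fx sx]; rewrite /star/= in sx.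
    split; last by rewrite /star/=; ends.
    apply/kernelP; rewrite morph_opp fx src_opp -!zero_one.
    symmetry; apply: opp_unique => //.
    by rewrite -{1}(src_zero H (vertex_map _ _)) add_zerol src_zero.
(* The witnesses for the two inclusions are the additive conjugates of [x] by [a], one on each
   side. *)
- move=> a; apply/seteqP; split=> z [x [kx sx] <-]; rewrite /star/= in sx.
  + have sy : src (a + x + - a) = src a by ends.
    have e : a + x = (a + x + - a) + a by rewrite addgKV//; ends.
    exists (a + x + - a); last by [].
    by split=> //; apply/(kernel_add_comm sx sy e).
  + have sy : src (- a + (x + a)) = src a by ends.
    have e : a + (- a + (x + a)) = x + a by rewrite addKVg//; ends.
    exists (- a + (x + a)); last by [].
    by split=> //; apply/(kernel_add_comm sy sx e).
(* Here [f x] is the unit at the target of [f a], so [act a x] is sent to [- f a + f a]. *)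
- move=> a z [x [/kernelP fx sx] <-]; rewrite /star/= in sx.
  split; last by rewrite /star/= src_act.
  apply/kernelP; rewrite src_act// /act morph_add; last by ends.
  rewrite morph_mul// fx sx -morph_tgt mul_oner morph_opp add_oppl.
  by rewrite zero_one morph_src.
Qed.

End Kernel.

(** * The congruence modulo an ideal *)

Section Congruence.
Context (V : Type) (G : quiver_skew_brace V) (I : set G).
Hypothesis idI : ideal I.
Implicit Types a b c i j x y : G.

Definition ideal_rel a b := exists i j,
  [/\ I i, I j, tgt i = src a, tgt a = src j & b = i * a * j].

Lemma idl_one v : I (one G v).
Proof. by have [[[]]] := idI. Qed.

Lemma idl_mul x y : I x -> I y -> tgt x = src y -> I (x * y).
Proof. by have [[[_ h _] _] _ _ _] := idI; apply: h. Qed.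

Lemma idl_inv x : I x -> I (inv x).
Proof. by have [[[_ _ h] _] _ _ _] := idI; apply: h. Qed.

Lemma idl_conj g x : I x -> src x = src g -> tgt x = src g -> I (inv g * x * g).
Proof. by have [[_ h] _ _ _] := idI; apply: h. Qed.

Lemma idl_add x y : I x -> I y -> src x = src y -> I (x + y).
Proof.
move=> Ix Iy xy; have [_ /(_ (src y)) [_ _ h _] _ _] := idI.
by have [] : star_in I (src y) (x + y) by apply: h.
Qed.

Lemma idl_opp x : I x -> I (- x).
Proof.
move=> Ix; have [_ /(_ (src x)) [_ _ _ h] _ _] := idI.
by have [] : star_in I (src x) (- x) by apply: h.
Qed.

Lemma idl_add_comm a x : I x -> src x = src a ->
  exists y, [/\ I y, src y = src a & x + a = a + y].
Proof.
move=> Ix xa; have [_ _ /(_ a) e _] := idI.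
have : [set x + a | x in star_in I (src a)] (x + a) by exists x.
by rewrite -e => -[y [Iy ya] <-]; exists y.
Qed.

Lemma idl_act a x : I x -> tgt a = src x -> I (- a + a * x).
Proof.
move=> Ix ax; have [_ _ _ /(_ a) h] := idI.
by have [] : star_in I (src a) (act a x) by apply: h; exists x.
Qed.

Lemma ideal_relxx a : ideal_rel a a.
Proof.
exists (one G (src a)), (one G (tgt a)).
by split; rewrite ?src_one ?tgt_one ?mul_onel ?mul_oner//; apply: idl_one.
Qed.

Lemma ideal_rel_sym a b : ideal_rel a b -> ideal_rel b a.
Proof.
move=> [i [j [Ii Ij ia aj ->]]]; exists (inv i), (inv j).
split; [exact: idl_inv|exact: idl_inv|ends|ends|].
rewrite -(@mul_assoc _ _ i) 1?mulKg ?mulgK//; ends.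
Qed.

Lemma ideal_rel_trans a b c : ideal_rel a b -> ideal_rel b c -> ideal_rel a c.
Proof.
move=> [i [j [Ii Ij ia aj ->]]] [k [l [Ik Il]]].
rewrite src_mul; last by ends.
rewrite src_mul// tgt_mul; last by ends.
move=> ki jl ->; exists (k * i), (j * l).
split; [exact: idl_mul|exact: idl_mul|ends|ends|].
rewrite -!mul_assoc//; ends.
Qed.

(** In [i * a * j * k * b * l], composability of both products makes [j * k] a loop at [src b];
    normality lets it pass to the right of [b] as its conjugate. *)
Lemma ideal_rel_mul a a' b b' : ideal_rel a a' -> ideal_rel b b' ->
  tgt a = src b -> tgt a' = src b' -> ideal_rel (a * b) (a' * b').
Proof.
move=> [i [j [Ii Ij ia aj ->]]] [k [l [Ik Il kb bl ->]]] ab.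
rewrite tgt_mul; last by ends.
rewrite src_mul; last by ends.
rewrite src_mul// => jk.
exists i, (inv b * (j * k) * b * l).
have Ijk : I (inv b * (j * k) * b).
  by apply: idl_conj; [exact: idl_mul|ends|ends].
split; [by []|by apply: idl_mul => //; ends|ends|ends|].
rewrite -!mul_assoc; try ends.
rewrite (@mulKVg _ _ b)//; ends.
Qed.

Lemma ideal_relMl i a : I i -> tgt i = src a -> ideal_rel a (i * a).
Proof.
move=> Ii ia; exists i, (one G (tgt a)); split; rewrite ?src_one//.
  exact: idl_one.
by rewrite -(tgt_mul ia) mul_oner.
Qed.

(* Both cosets [a I] and [a + I] coincide since [a x = a + (a |> x)]. *)
Lemma ideal_rel_star a b : src a = src b ->
  ideal_rel a b <-> exists x, [/\ I x, src x = src a & b = a + x].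
Proof.
move=> ab; split=> [[i [j [Ii Ij ia aj e]]]|[x [Ix xa ->]]].
- have sb : src b = src i by rewrite e; ends.
  (* Equal sources make [i] a loop, hence [b = a * y] with [y = inv a * i * a * j] in [I]; the
     additive witness is then [act a y]. *)
  have Ik : I (inv a * i * a) by apply: idl_conj => //; congruence.
  exists (- a + a * (inv a * i * a * j)); split.
  + by apply: idl_act; [apply: idl_mul => //; ends|ends].
  + ends.
  + rewrite addKVg; last by ends.
    rewrite e -!mul_assoc; try ends.
    rewrite mulKVg//; ends.
(* By distributivity the right factor equals [act (inv a) x]. *)
- exists (one G (src a)), (inv a * (a + x)).
  split; rewrite ?mul_onel; [exact: idl_one| |ends|ends|].
  + rewrite mul_add; [|ends|ends].
    rewrite mul_invl -zero_one -{1}(src_inv a) -(src_opp (inv a)) add_zerol.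
    by apply: idl_act; [|ends].
  + rewrite mulKVg//; ends.
Qed.

(** Additive normality gives [x + b = b + z], so that [(a + x) + (b + y) = (a + b) + (z + y)]. *)
Lemma ideal_rel_add_star a a' b b' : src a = src b -> src a' = src a ->
  src b' = src a -> ideal_rel a a' -> ideal_rel b b' ->
  ideal_rel (a + b) (a' + b').
Proof.
move=> ab a'a b'a /ideal_rel_star [//|x [Ix xa ->]].
move=> /ideal_rel_star [|y [Iy yb ->]]; first by congruence.
have [||z [Iz zb xb]] := @idl_add_comm b x; [by []|congruence|].
apply/ideal_rel_star; first by ends.
exists (z + y); split; [apply: idl_add => //; congruence|ends|].
rewrite -!add_assoc; try ends.
rewrite (@add_assoc _ _ x); try ends.
rewrite xb -!add_assoc//; ends.
Qed.

(** With its analogue for targets, this shows that endpoints are well defined on classes once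
    vertices joined by [I] are identified. *)
Lemma ideal_rel_connect a b : ideal_rel a b ->
  exists i, [/\ I i, src i = src b & tgt i = src a].
Proof. by move=> [i [j [Ii Ij ia aj ->]]]; exists i; split=> //; ends. Qed.

Lemma ideal_rel_connect_tgt a b : ideal_rel a b ->
  exists i, [/\ I i, src i = tgt b & tgt i = tgt a].
Proof.
move=> [i [j [Ii Ij ia aj ->]]]; exists (inv j); split; [exact: idl_inv|ends|ends].
Qed.

(* Left translation by [i] in [I] is additive modulo [I]:
   [i (a + b) = i a - i + i b]. *)
Lemma ideal_rel_addMl i a b : I i -> tgt i = src a -> tgt i = src b ->
  ideal_rel (a + b) (i * a + i * b).
Proof.
move=> Ii ia ib.
have : ideal_rel (a + b) (i * (a + b)) by apply: ideal_relMl => //; ends.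
move/ideal_rel_trans; apply; rewrite mul_add// -add_assoc; try ends.
apply: ideal_rel_add_star; [ends|ends|ends|exact: ideal_relxx|].
have [||z [Iz zb ->]] := @idl_add_comm (i * b) (- i); [exact: idl_opp|ends|].
apply: ideal_rel_sym; apply/ideal_rel_star; first by ends.
by exists z.
Qed.

(** An arrow of [I] from [src a'] to [src a] translates [a] and [b] into the star of [a'] and [b'],
    reducing to the case of one star. *)
Lemma ideal_rel_add a a' b b' : ideal_rel a a' -> ideal_rel b b' ->
  src a = src b -> src a' = src b' -> ideal_rel (a + b) (a' + b').
Proof.
move=> aa' bb' ab a'b'; have [i [Ii ia' ia]] := ideal_rel_connect aa'.
have ib : tgt i = src b by congruence.
apply: ideal_rel_trans (ideal_rel_addMl Ii ia ib) _.
apply: ideal_rel_add_star; [ends|ends|ends| |].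
- exact: ideal_rel_trans (ideal_rel_sym (ideal_relMl Ii ia)) aa'.
- exact: ideal_rel_trans (ideal_rel_sym (ideal_relMl Ii ib)) bb'.
Qed.

(** With the converse below, [I] is the union of the classes of units, that is, the kernel of the
    projection. *)
Lemma idl_rel_one x v : I x -> src x = v -> ideal_rel (one G v) x.
Proof.
move=> Ix <-; rewrite -{2}(mul_onel x).
exists (one G (src x)), x; split; rewrite ?src_one ?tgt_one//.
  exact: idl_one.
by rewrite -(mul_assoc (x := one G (src x))) ?mul_onel// ?tgt_one ?src_one.
Qed.

Lemma rel_one_idl x v : ideal_rel (one G v) x -> I x.
Proof.
move=> [i [j [Ii Ij]]]; rewrite src_one tgt_one => iv vj ->.
by rewrite -iv mul_oner; apply: idl_mul => //; congruence.
Qed.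

(** Both units are congruent to [i]. *)
Lemma ideal_rel_ones i : I i -> ideal_rel (one G (src i)) (one G (tgt i)).
Proof.
move=> Ii; apply: ideal_rel_trans (idl_rel_one Ii erefl) _.
rewrite -(mul_invl i); apply: ideal_relMl; first exact: idl_inv.
by rewrite tgt_inv.
Qed.

End Congruence.

(** Classes are taken as subsets of [T], equal by extensionality. This serves both vertices and
    arrows. *)
Lemma quotient_exists (T : Type) (e : T -> T -> Prop) :
    (forall x, e x x) -> (forall x y, e x y -> e y x) ->
    (forall x y z, e x y -> e y z -> e x z) ->
  exists (Q : Type) (p : T -> Q), (forall q, exists x, p x = q) /\
    forall x y, p x = p y <-> e x y.
Proof.
move=> exx es et; exists {A : set T | exists x, A = e x}.
exists (fun x => exist _ (e x) (ex_intro _ x erefl)); split.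
- by move=> [A [x eA]]; exists x; apply: eq_exist.
- move=> x y; split=> [[->] //|exy]; apply: eq_exist; apply/funext => z.
  by apply/propext; split; [apply/et/es|apply/et].
Qed.

(** * The quotient by an ideal *)

Section Quotient.
Context (V W : Type) (G : quiver_skew_brace V) (I : set G).
(** An abstract vertex projection [q] with section [s] covers both statements: a class map for a
    general ideal, the identity for an ideal bundle. *)
Context (q : V -> W) (s : W -> V).
Hypothesis idI : ideal I.
Hypothesis qK : forall w, q (s w) = w.
Hypothesis qP : forall v w, q v = q w <-> exists i, [/\ I i, src i = v & tgt i = w].

(* Choosing representatives of arrows between representatives of vertices makes
   composability in the quotient the same as composability in [G]. *)
Lemma ideal_quotient_arrows : exists (Q : Type) (p : G -> Q) (r : Q -> G),
  [/\ forall t, p (r t) = t,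
      forall a b, p a = p b <-> ideal_rel I a b,
      forall a, src (r (p a)) = s (q (src a))
    & forall a, tgt (r (p a)) = s (q (tgt a))].
Proof.
have [Q [p [pS pP]]] := quotient_exists (ideal_relxx idI)
  (@ideal_rel_sym _ _ _ idI) (@ideal_rel_trans _ _ _ idI).
have ex t : exists b, p b = t /\
    (src b = s (q (src b)) /\ tgt b = s (q (tgt b))).
  have [a <-] := pS t.
  (* Multiplying by arrows of [I] on both sides moves [a] between chosen vertices within its
     class. *)
  have [i [Ii si ti]] : exists i, [/\ I i, src i = s (q (src a)) & tgt i = src a].
    by apply/qP; rewrite qK.
  have [j [Ij sj tj]] : exists j, [/\ I j, src j = tgt a & tgt j = s (q (tgt a))].
    by apply/qP; rewrite qK.
  exists (i * a * j); split.
    by apply/pP/(ideal_rel_sym idI); exists i, j.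
  rewrite src_mul; last by ends.
  rewrite src_mul// tgt_mul; last by ends.
  by rewrite si tj !qK.
have [r rP] := choice ex; exists Q, p, r; split=> // [t|a|a].
- by have [] := rP t.
- have [/pP/(ideal_rel_connect) [i [Ii si ti]] [-> _]] := rP (p a).
  by congr s; symmetry; apply/qP; exists i.
- have [/pP/(ideal_rel_connect_tgt idI) [i [Ii si ti]] [_ ->]] := rP (p a).
  by congr s; symmetry; apply/qP; exists i.
Qed.

(** Operations are computed on the representatives [r t]. Each axiom comes from the one in [G],
    since products and sums of congruent arrows are congruent. *)
Lemma ideal_quotient : exists (H : quiver_skew_brace W) (f : brace_morphism G H),
  vertex_map f = q /\ I = kernel f.
Proof.
have [Q [p [r [rK pP sr tr]]]] := ideal_quotient_arrows.
have pM a a' b b' : p a = p a' -> p b = p b' -> tgt a = src b ->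
    tgt a' = src b' -> p (a * b) = p (a' * b').
  by move=> /pP aa' /pP bb' ab a'b'; apply/pP; apply: ideal_rel_mul.
have pD a a' b b' : p a = p a' -> p b = p b' -> src a = src b ->
    src a' = src b' -> p (a + b) = p (a' + b').
  by move=> /pP aa' /pP bb' ab a'b'; apply/pP; apply: ideal_rel_add.
(* Endpoints of representatives are fixed by the composite of [q] and [s], so equality of their
   images under [q] is genuine equality. *)
have qsr t : s (q (src (r t))) = src (r t) by rewrite -{2}(rK t) sr.
have qtr t : s (q (tgt (r t))) = tgt (r t) by rewrite -{2}(rK t) tr.
have comp t u : q (tgt (r t)) = q (src (r u)) -> tgt (r t) = src (r u).
  by move=> e; rewrite -qtr e qsr.
have coinit t u : q (src (r t)) = q (src (r u)) -> src (r t) = src (r u).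
  by move=> e; rewrite -qsr e qsr.
have @H0 : groupoid W.
  refine (@Groupoid W Q (fun t => q (src (r t))) (fun t => q (tgt (r t)))
    (fun w => p (one G (s w))) (fun t u => p (r t * r u))
    (fun t => p (inv (r t))) _ _ _ _ _ _ _ _ _ _ _).
  - by move=> w; rewrite sr src_one !qK.
  - by move=> w; rewrite tr tgt_one !qK.
  - by move=> x y /comp xy; rewrite sr qK src_mul.
  - by move=> x y /comp xy; rewrite tr qK tgt_mul.
  - move=> x y z /comp xy /comp yz.
    (* The nested representative of the class of [r y * r z] is replaced by [r y * r z] itself; the
       later axioms are treated likewise. *)
    transitivity (p (r x * (r y * r z))).
      by apply: (pM) => //; rewrite ?rK ?sr ?src_mul ?qsr.
    rewrite mul_assoc//; apply: (pM); rewrite ?rK ?tr ?tgt_mul ?qtr//.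
  - move=> x; transitivity (p (one G (src (r x)) * r x));
      last by rewrite mul_onel rK.
    by rewrite -{2}qsr; apply: (pM); rewrite ?rK ?tr ?tgt_one ?qK.
  - move=> x; transitivity (p (r x * one G (tgt (r x))));
      last by rewrite mul_oner rK.
    by rewrite -{2}qtr; apply: (pM); rewrite ?rK ?sr ?src_one ?qK.
  - by move=> x; rewrite sr src_inv qK.
  - by move=> x; rewrite tr tgt_inv qK.
  - move=> x; rewrite qsr -mul_invr.
    by apply: (pM); rewrite ?rK ?sr ?src_inv ?qtr.
  - move=> x; rewrite qtr -mul_invl.
    by apply: (pM); rewrite ?rK ?tr ?tgt_inv ?qsr.
have @H : quiver_skew_brace W.
  refine (@QuiverSkewBrace W H0 (fun w => p (zero G (s w)))
    (fun t u => p (r t + r u)) (fun t => p (- r t)) _ _ _ _ _ _ _ _ _) => /=.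
  - by move=> w; rewrite sr src_zero !qK.
  - by move=> x y /coinit xy; rewrite sr qK src_add.
  - by move=> x; rewrite sr src_opp qK.
  - move=> x y z /coinit xy /coinit yz.
    transitivity (p (r x + (r y + r z))).
      by apply: (pD); rewrite ?rK ?sr ?src_add ?qsr.
    by rewrite add_assoc//; apply: (pD); rewrite ?rK ?sr ?src_add ?qsr ?xy.
  - move=> x; transitivity (p (zero G (src (r x)) + r x));
      last by rewrite add_zerol rK.
    by rewrite -{2}qsr; apply: (pD); rewrite ?rK ?sr ?src_zero ?qK.
  - move=> x; transitivity (p (r x + zero G (src (r x))));
      last by rewrite add_zeror rK.
    by rewrite -{2}qsr; apply: (pD); rewrite ?rK ?sr ?src_zero ?qK.
  - by move=> x; rewrite qsr -add_oppl; apply: (pD); rewrite ?rK ?sr ?src_opp ?qsr.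
  - by move=> x; rewrite qsr -add_oppr; apply: (pD); rewrite ?rK ?sr ?src_opp ?qsr.
  - move=> a b c /comp ab /comp ac.
    transitivity (p (r a * (r b + r c))).
      by apply: (pM); rewrite ?rK ?sr ?src_add ?qsr -?ab.
    rewrite mul_add//; apply: (pD); rewrite ?rK.
    + by apply: (pD); rewrite ?rK ?sr ?src_mul ?src_opp ?qsr.
    + by [].
    + by rewrite src_add !src_mul// src_opp.
    + by rewrite !sr src_add sr !src_mul// ?sr ?src_opp !qsr.
have g_mor x y : tgt x = src y -> p (x * y) = p (r (p x) * r (p y)).
  by move=> xy; apply: (pM); rewrite ?rK ?sr ?tr ?xy.
have g_src x : q (src (r (p x))) = q (src x) by rewrite sr qK.
have g_tgt x : q (tgt (r (p x))) = q (tgt x) by rewrite tr qK.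
pose g : groupoid_morphism G H :=
  @GroupoidMorphism V W G H p q g_src g_tgt g_mor.
have g_add x y : src x = src y -> g (x + y) = g x + g y.
  by move=> xy; apply: (pD); rewrite ?rK ?sr ?xy.
exists H, (BraceMorphism g_add); split=> //.
apply/seteqP; split=> x.
- move=> Ix; exists (q (src x)); symmetry; apply/pP.
  (* The unit of the quotient is the class of a unit at the chosen vertex; [i] makes it congruent to
     the unit at [src x], hence to [x]. *)
  have [i [Ii si ti]] : exists i, [/\ I i, src i = s (q (src x)) & tgt i = src x].
    by apply/qP; rewrite qK.
  have := ideal_rel_ones idI Ii; rewrite si ti => /(ideal_rel_trans idI); apply.
  exact: idl_rel_one.
- by move=> [w /esym/pP]; apply: rel_one_idl.
Qed.

End Quotient.

Theorem proposition2p3 (V : Type) (G : quiver_skew_brace V) :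
  (forall I : set G,
     ideal I <->
     exists (W : Type) (H : quiver_skew_brace W) (f : brace_morphism G H),
       I = kernel f) /\
  (forall I : set G,
     ideal_bundle I <->
     exists (H : quiver_skew_brace V) (f : brace_morphism G H),
       strong f /\ I = kernel f).
Proof.
split=> I; split.
(* The new vertices are the connected components of [I], and choice picks a vertex in each. *)
- move=> idI; pose e v w := exists i : G, [/\ I i, src i = v & tgt i = w].
  have [|||W [q [qS qP]]] := @quotient_exists V e.
  + by move=> v; exists (one G v); rewrite src_one tgt_one; split=> //; exact: idl_one.
  + move=> v w [i [Ii si ti]]; exists (inv i).
    by rewrite src_inv tgt_inv; split=> //; exact: idl_inv.
  + move=> u v w [i [Ii si ti]] [j [Ij sj tj]]; exists (i * j).
    by split; [apply: idl_mul => //; congruence|ends|ends].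
  have [s sK] := choice qS.
  by have [H [f [_ ->]]] := ideal_quotient idI sK qP; exists W, H, f.
- by move=> [W [H [f ->]]]; exact: kernel_ideal.
- move=> [idI loopI].
  (* Since all arrows of [I] are loops, only equal vertices are joined, and the identity can serve
     as vertex map. *)
  have [//|v w|H [f [fq ->]]] := @ideal_quotient V V G I id id idI.
    split=> [<-|[i [Ii <- <-]]]; last exact: loopI.
    by exists (one G v); rewrite src_one tgt_one; split=> //; exact: idl_one.
  by exists H, f; split=> // v; rewrite fq.
- move=> [H [f [sf ->]]]; split; first exact: kernel_ideal.
  by move=> x /kernel_ends; rewrite !sf.
Qed.
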